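(* The non-associative Lambek calculus is sound and complete in the frame class $\mathbb{LK}$: for all sentences $\varphi,\psi$, the sequent $\varphi\vdash\psi$ is provable if and only if $[\![\varphi]\!]_{\mathfrak{M}}\subseteq[\![\psi]\!]_{\mathfrak{M}}$ for every model $\mathfrak{M}=(\mathfrak{F},V)$ on a frame $\mathfrak{F}\in\mathbb{LK}$.
   Context: Logic. The non-associative Lambek calculus is the logic of partially ordered residuated unital groupoids $(P,\leq,1,\mathtt{e},\leftarrow,\circ,\to)$: $1$ is the greatest element, $a\leq c\leftarrow b$ iff $a\circ b\leq c$ iff $b\leq a\to c$, and $a\circ\mathtt{e}=a=\mathtt{e}\circ a$. Sentences: $\varphi::=p_i\,(i\in\mathbb{N})\mid\top\mid\mathtt{t}\mid\varphi\leftarrow\varphi\mid\varphi\circ\varphi\mid\varphi\to\varphi$. Sequents $\varphi\vdash\psi$ are generated by: $\varphi\vdash\varphi$; $\varphi\vdash\top$; cut; uniform substitution; two-way residuation rules $\varphi\vdash\vartheta\leftarrow\psi$ iff $\varphi\circ\psi\vdash\vartheta$ iff $\psi\vdash\varphi\to\vartheta$; and $\mathtt{t}\circ\varphi\vdash\varphi$, $\varphi\vdash\mathtt{t}\circ\varphi$, $\varphi\circ\mathtt{t}\vdash\varphi$, $\varphi\vdash\varphi\circ\mathtt{t}$. Frames. $\mathfrak{F}=(W_1,W_\partial,I,U,S,R,T)$: $W_1,W_\partial$ nonempty sets (not necessarily disjoint), $I\subseteq W_1\times W_\partial$, $U\subseteq W_1$, $S\subseteq W_\partial\times(W_\partial\times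 W_1)$, $R\subseteq W_1\times(W_1\times W_1)$, $T\subseteq W_\partial\times(W_1\times W_\partial)$. Let $\perp$ be the complement of $I$; $A'=\{y\in W_\partial\mid\forall x\in A\;x\perp y\}$ for $A\subseteq W_1$, $B'=\{x\in W_1\mid\forall y\in B\;x\perp y\}$ for $B\subseteq W_\partial$. Galois sets: $G=G''$ (stable in $W_1$, co-stable in $W_\partial$). On each sort, $u\leq w$ iff $\{u\}'\subseteq\{w\}'$. For a relation $Q\in\{S,R,T\}$, $Quw=\{z\mid zQuw\}$, and its Galois dual $Q'$ is defined by $zQ'uw$ iff $z\in(Quw)'$. $\mathbb{LK}$ is the class of frames satisfying (with $x,z,z_1,z_2\in W_1$, $v,y\in W_\partial$): (F1) all sections $Txv$, $Rxz$, $Svx$ are Galois sets; (RES) for all $x,z,v$: $xS'vz$ iff $vR'xz$ iff $zT'xv$; (U$^*$) $U$ is Galois stable; (F2.1) $\forall x,z_1,z_2(xRz_1z_2\to(z_1\in U\to z_2\leq x))$; (F2.2) $\forall x,z_1,z_2(xRz_1z_2\to(z_2\in U\to z_1\leq x))$; (F3.1) $\forall x\forall y(xIy\to\exists z(zIy\wedge\exists z_1,z_2(z_1\in U\wedge zRz_1z_2\wedge x\leq z_2)))$; (F3.2) $\forall x\forall y(xIy\to\exists z(zIy\wedge\exists z_1,z_2(z_2\in U\wedge zRz_1z_2\wedge x\leq z_1)))$. Models. $V$ assigns a Galois stable set to each $p_i$. $[\![p_i]\!]=V(p_i)$, $[\![\top]\!]=W_1$, $[\![\mathtt{t}]\!]=U$,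 and $[\![\varphi\to\psi]\!]=\{z\in W_1\mid\forall x\in[\![\varphi]\!]\forall v\in[\![\psi]\!]'\;zT'xv\}$, $[\![\varphi\circ\psi]\!]=\{v\in W_\partial\mid\forall x\in[\![\varphi]\!]\forall z\in[\![\psi]\!]\;vR'xz\}'$, $[\![\psi\leftarrow\varphi]\!]=\{x\in W_1\mid\forall z\in[\![\varphi]\!]\forall v\in[\![\psi]\!]'\;xS'vz\}$. *)

(* Defs.v *)
From mathcomp Require Import all_boot.
From mathcomp Require Import boolp classical_sets.

Set Implicit Arguments.
Unset Strict Implicit.
Unset Printing Implicit Defensive.

Local Open Scope classical_set_scope.

Inductive sentence : Type :=
| Var of nat
| Top
| Unit
| LImp of sentence & sentence (* [LImp f g] is f <- g *)
| Fus of sentence & sentence  (* [Fus f g] is f o g *)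
| RImp of sentence & sentence (* [RImp f g] is f -> g *).

Fixpoint subst (s : nat -> sentence) (f : sentence) : sentence :=
  match f with
  | Var i => s i
  | Top => Top
  | Unit => Unit
  | LImp g h => LImp (subst s g) (subst s h)
  | Fus g h => Fus (subst s g) (subst s h)
  | RImp g h => RImp (subst s g) (subst s h)
  end.

Inductive provable : sentence -> sentence -> Prop :=
| prov_id f : provable f f
| prov_top f : provable f Top
| prov_cut f g h : provable f g -> provable g h -> provable f h
| prov_subst s f g : provable f g -> provable (subst s f) (subst s g)
| prov_LImp_Fus f g h : provable f (LImp h g) -> provable (Fus f g) h
| prov_Fus_LImp f g h : provable (Fus f g) h -> provable f (LImp h g)
| prov_RImp_Fus f g h : provable g (RImp f h) -> provable (Fus f g) h
| prov_Fus_RImp f g h : provable (Fus f g) h -> provable g (RImp f h)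
| prov_unitl_elim f : provable (Fus Unit f) f
| prov_unitl_intro f : provable f (Fus Unit f)
| prov_unitr_elim f : provable (Fus f Unit) f
| prov_unitr_intro f : provable f (Fus f Unit).

(* In the relations S, R, T the first argument is the output one:
   [relR x z1 z2] is x R z1 z2. *)
Record frame := Frame {
  W1 : Type;
  Wd : Type;
  W1_nonempty : inhabited W1;
  Wd_nonempty : inhabited Wd;
  relI : W1 -> Wd -> Prop;
  unitU : set W1;
  relS : Wd -> Wd -> W1 -> Prop;
  relR : W1 -> W1 -> W1 -> Prop;
  relT : Wd -> W1 -> Wd -> Prop
}.

Arguments unitU f : clear implicits.

Section FrameTheory.
Variable F : frame.
Notation W1 := (W1 F).
Notation Wd := (Wd F).

Definition perp (x : W1) (y : Wd) : Prop := ~ relI x y.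

(* The two Galois maps, both written with a prime in the literature. *)
Definition pol1 (A : set W1) : set Wd := [set y | forall x, A x -> perp x y].
Definition pold (B : set Wd) : set W1 := [set x | forall y, B y -> perp x y].

Definition stable (A : set W1) : Prop := A = pold (pol1 A).
Definition costable (B : set Wd) : Prop := B = pol1 (pold B).

Definition le1 (u w : W1) : Prop := pol1 [set u] `<=` pol1 [set w].

Definition secS (v : Wd) (x : W1) : set Wd := [set z | relS z v x].
Definition secR (x z : W1) : set W1 := [set w | relR w x z].
Definition secT (x : W1) (v : Wd) : set Wd := [set z | relT z x v].

Definition dualS (x : W1) (v : Wd) (z : W1) : Prop := pold (secS v z) x.
Definition dualR (v : Wd) (x z : W1) : Prop := pol1 (secR x z) v.
Definition dualT (z : W1) (x : W1) (v : Wd) : Prop := pold (secT x v) z.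

Record LK : Prop := {
  LK_F1_T : forall x v, costable (secT x v);
  LK_F1_R : forall x z, stable (secR x z);
  LK_F1_S : forall v x, costable (secS v x);
  LK_RES : forall x z v,
    (dualS x v z <-> dualR v x z) /\ (dualR v x z <-> dualT z x v);
  LK_U : stable (unitU F);
  LK_F21 : forall x z1 z2 : W1, relR x z1 z2 -> unitU F z1 -> le1 z2 x;
  LK_F22 : forall x z1 z2 : W1, relR x z1 z2 -> unitU F z2 -> le1 z1 x;
  LK_F31 : forall (x : W1) (y : Wd), relI x y ->
    exists z : W1, relI z y /\
      exists z1 z2 : W1, [/\ unitU F z1, relR z z1 z2 & le1 x z2];
  LK_F32 : forall (x : W1) (y : Wd), relI x y ->
    exists z : W1, relI z y /\
      exists z1 z2 : W1, [/\ unitU F z2, relR z z1 z2 & le1 x z1]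
}.

Fixpoint interp (V : nat -> set W1) (f : sentence) : set W1 :=
  match f with
  | Var i => V i
  | Top => setT
  | Unit => unitU F
  | LImp h g => [set x | forall z v,
      interp V g z -> pol1 (interp V h) v -> dualS x v z]
  | Fus g h => pold [set v | forall x z,
      interp V g x -> interp V h z -> dualR v x z]
  | RImp g h => [set z | forall x v,
      interp V g x -> pol1 (interp V h) v -> dualT z x v]
  end.

End FrameTheory.

Record model := Model {
  model_frame : frame;
  valuation : nat -> set (W1 model_frame);
  valuation_stable : forall i, stable (valuation i)
}.

Definition sem (M : model) (f : sentence) : set (W1 (model_frame M)) :=
  interp (@valuation M) f.
Arguments sem M f : clear implicits.

(* Main.v *)
(** Completeness needs no filters or ideals: the frame whose two sorts are both
    the set of sentences, with [x] perpendicular to [y] iff [x |- y] (so that the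
    stable sets form the MacNeille completion of the Lindenbaum preorder), is
    already in LK, and with [V p_i = {x | x |- p_i}] every sentence [f] denotes
    [{x | x |- f}]. *)
Require Import Defs.
From mathcomp Require Import all_boot.
From mathcomp Require Import boolp classical_sets.

Set Implicit Arguments.
Unset Strict Implicit.
Unset Printing Implicit Defensive.

Local Open Scope classical_set_scope.

Section GaloisConnection.
Variable F : frame.
Implicit Types (A : set (W1 F)) (B : set (Wd F)).

Lemma sub_pold_pol1 A : A `<=` pold (pol1 A).
Proof. by move=> x Ax y; apply. Qed.

Lemma stableP A : pold (pol1 A) `<=` A -> stable A.
Proof. by move=> sA; apply/seteqP; split=> //; exact: sub_pold_pol1. Qed.

Lemma stable_sub A : stable A -> pold (pol1 A) `<=` A.
Proof. by move=> {2}->. Qed.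

Lemma pold_stable B : stable (pold B).
Proof. by apply: stableP => x Bx y By; apply: Bx => z; apply. Qed.

Lemma pol1_costable A : costable (pol1 A).
Proof.
apply/seteqP; split=> [y Ay x|y Ay x Ax]; first exact.
by apply: Ay; exact: sub_pold_pol1.
Qed.

(** Each [y] in [pol1 A] is orthogonal to [u], hence to [w], so [w] lies in the closure of [A]:
    stable sets are upward closed. *)
Lemma stable_le1 A u w : stable A -> le1 u w -> A u -> A w.
Proof.
move=> sA uw Au; apply: (stable_sub sA) => y Ay.
by apply: (uw y) => // x ->; exact: Ay.
Qed.

End GaloisConnection.

Section Soundness.
Variable F : frame.
Hypothesis hF : LK F.
Variable V : nat -> set (W1 F).
Hypothesis hV : forall i, stable (V i).

Lemma interp_stable f : stable (interp V f).
Proof.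
case: f => [i|||h g|g h|g h] /=.
- exact: hV.
- exact: stableP.
- exact: LK_U hF.
- apply: stableP => x Hx z v gz hv y Sy.
  by apply: Hx => w /(_ z v gz hv); apply.
- exact: pold_stable.
- apply: stableP => z Hz x v gx hv y Ty.
  by apply: Hz => w /(_ x v gx hv); apply.
Qed.

(** This brings an inclusion out of a fusion into the shape of the two implication clauses, so that
    (RES) alone yields residuation. *)
Lemma interp_Fus_subP f g h :
  interp V (Fus f g) `<=` interp V h <->
  (forall x z v, interp V f x -> interp V g z -> pol1 (interp V h) v ->
    dualR v x z).
Proof.
split=> [sub x z v fx gz hv w Rw|H x Hx].
  by apply: hv; apply: sub => u; move/(_ x z fx gz); apply.
apply: (stable_sub (interp_stable h)) => v hv.
by apply: Hx => a b fa gb; exact: H.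
Qed.

Lemma interp_LImp_subP f g h :
  interp V f `<=` interp V (LImp h g) <-> interp V (Fus f g) `<=` interp V h.
Proof.
rewrite interp_Fus_subP; split=> [sub x z v fx gz hv|H x fx z v gz hv].
  by apply/(LK_RES hF x z v).1; exact: sub.
by apply/(LK_RES hF x z v).1; exact: H.
Qed.

Lemma interp_RImp_subP f g h :
  interp V g `<=` interp V (RImp f h) <-> interp V (Fus f g) `<=` interp V h.
Proof.
rewrite interp_Fus_subP; split=> [sub x z v fx gz hv|H z gz x v fx hv].
  by apply/(LK_RES hF x z v).2; exact: sub.
by apply/(LK_RES hF x z v).2; exact: H.
Qed.

Lemma interp_unitl f : interp V (Fus Unit f) = interp V f.
Proof.
apply/seteqP; split.
  apply/interp_Fus_subP => x z v Ux fz fv w Rw; apply: fv.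
  exact: stable_le1 (interp_stable f) (LK_F21 hF Rw Ux) fz.
(* Assume [relI x v]. (F3.1) gives [z] in [secR z1 z2] with [relI z v], where [z1] is in [U] and
   [z2] is above [x], hence in the denotation of [f]; this contradicts [dualR v z1 z2]. *)
move=> x fx v Hv xv.
have [z [zv [z1 [z2 [Uz1 Rz xz2]]]]] := LK_F31 hF xv.
by apply: (Hv z1 z2 Uz1 _ z Rz zv); exact: stable_le1 (interp_stable f) xz2 fx.
Qed.

Lemma interp_unitr f : interp V (Fus f Unit) = interp V f.
Proof.
apply/seteqP; split.
  apply/interp_Fus_subP => x z v fx Uz fv w Rw; apply: fv.
  exact: stable_le1 (interp_stable f) (LK_F22 hF Rw Uz) fx.
move=> x fx v Hv xv.
have [z [zv [z1 [z2 [Uz2 Rz xz1]]]]] := LK_F32 hF xv.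
by apply: (Hv z1 z2 _ Uz2 z Rz zv); exact: stable_le1 (interp_stable f) xz1 fx.
Qed.

Lemma interp_subst s f :
  interp V (subst s f) = interp (fun i => interp V (s i)) f.
Proof. by elim: f => //= [g -> h ->|g -> h ->|g -> h ->]. Qed.

End Soundness.

(** The valuation is quantified after the derivation because the substitution rule uses the
    induction hypothesis at [fun i => interp V (s i)]. *)
Lemma soundness F (hF : LK F) f g : provable f g ->
  forall V : nat -> set (W1 F), (forall i, stable (V i)) ->
  interp V f `<=` interp V g.
Proof.
elim=> {f g} [f|f|f g h _ IHfg _ IHgh|s f g _ IH|f g h _ IH|f g h _ IH
             |f g h _ IH|f g h _ IH|f|f|f|f] V hV.
- by [].
- by [].
- exact: subset_trans (IHfg V hV) (IHgh V hV).
- by rewrite !interp_subst; apply: IH => i; exact: interp_stable.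
- by apply/interp_LImp_subP => //; exact: IH.
- by apply/interp_LImp_subP => //; exact: IH.
- by apply/interp_RImp_subP => //; exact: IH.
- by apply/interp_RImp_subP => //; exact: IH.
- by rewrite interp_unitl.
- by rewrite interp_unitl.
- by rewrite interp_unitr.
- by rewrite interp_unitr.
Qed.

Lemma provable_Fus f f' g g' :
  provable f f' -> provable g g' -> provable (Fus f g) (Fus f' g').
Proof.
move=> ff' gg'; apply: (@prov_cut _ (Fus f' g)).
  (* Residuation isolates the varying factor on the left, where cut replaces it. *)
  by apply/prov_LImp_Fus/(prov_cut ff')/prov_Fus_LImp/prov_id.
by apply/prov_RImp_Fus/(prov_cut gg')/prov_Fus_RImp/prov_id.
Qed.

Lemma provable_LImp f f' g g' :
  provable f f' -> provable g' g -> provable (LImp f g) (LImp f' g').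
Proof.
move=> ff' g'g; apply: prov_Fus_LImp; apply: prov_cut ff'.
apply: prov_cut (provable_Fus (prov_id _) g'g) _.
exact/prov_LImp_Fus/prov_id.
Qed.

Lemma provable_RImp f f' g g' :
  provable f' f -> provable g g' -> provable (RImp f g) (RImp f' g').
Proof.
move=> f'f gg'; apply: prov_Fus_RImp; apply: prov_cut gg'.
apply: prov_cut (provable_Fus f'f (prov_id _)) _.
exact/prov_RImp_Fus/prov_id.
Qed.

(** The relations are chosen so that every section is principal: the sentences below a fusion, or
    those above an implication. Polarity exchanges the two kinds, which gives (F1) and reduces (RES)
    to the residuation rules. *)
Definition canonical_frame : frame :=
  @Frame sentence sentence (inhabits Top) (inhabits Top)
    (fun x y => ~ provable x y)
    [set x | provable x Unit]
    (fun y v z => provable (LImp v z) y)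
    (fun x z1 z2 => provable x (Fus z1 z2))
    (fun y x v => provable (RImp x v) y).

Lemma canonical_perp x y : @perp canonical_frame x y <-> provable x y.
Proof. by split=> [/contrapT|xy nxy]. Qed.

Lemma canonical_pol1 f :
  @pol1 canonical_frame [set x | provable x f] = [set y | provable f y].
Proof.
apply/seteqP; split=> y /= Hy; first by apply/canonical_perp/Hy/prov_id.
by move=> x xf; apply/canonical_perp/(prov_cut xf).
Qed.

Lemma canonical_pold f :
  @pold canonical_frame [set y | provable f y] = [set x | provable x f].
Proof.
apply/seteqP; split=> x /= Hx; first by apply/canonical_perp/Hx/prov_id.
by move=> y fy; apply/canonical_perp/(prov_cut Hx).
Qed.

Lemma canonical_stable f : @stable canonical_frame [set x | provable x f].
Proof. by rewrite /stable canonical_pol1 canonical_pold. Qed.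

Lemma canonical_costable f : @costable canonical_frame [set y | provable f y].
Proof. by rewrite /costable canonical_pold canonical_pol1. Qed.

(** The order is reversed because a stronger sentence has more consequences, hence a larger polar;
    testing at [u] itself gives the forward direction. *)
Lemma canonical_le1 u w : @le1 canonical_frame u w <-> provable w u.
Proof.
split=> [uw|wu y uy].
  by apply/canonical_perp/(uw u) => // x ->; apply/canonical_perp/prov_id.
move=> x ->; apply/canonical_perp; apply: prov_cut wu _.
by apply/canonical_perp; exact: uy.
Qed.

Lemma canonical_dualS x v z :
  @dualS canonical_frame x v z <-> provable x (LImp v z).
Proof. by rewrite /dualS canonical_pold. Qed.

Lemma canonical_dualR v x z :
  @dualR canonical_frame v x z <-> provable (Fus x z) v.
Proof. by rewrite /dualR canonical_pol1. Qed.

Lemma canonical_dualT z x v :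
  @dualT canonical_frame z x v <-> provable z (RImp x v).
Proof. by rewrite /dualT canonical_pold. Qed.

Lemma canonical_LK : LK canonical_frame.
Proof.
split.
- by move=> x v; exact: canonical_costable.
- by move=> x z; exact: canonical_stable.
- by move=> v x; exact: canonical_costable.
- move=> x z v; rewrite canonical_dualS canonical_dualR canonical_dualT.
  split; split.
  + exact: prov_LImp_Fus.
  + exact: prov_Fus_LImp.
  + exact: prov_Fus_RImp.
  + exact: prov_RImp_Fus.
- exact: canonical_stable.
- move=> x z1 z2 Rx Uz1; apply/canonical_le1; apply: prov_cut Rx _.
  exact: prov_cut (provable_Fus Uz1 (prov_id _)) (prov_unitl_elim _).
- move=> x z1 z2 Rx Uz2; apply/canonical_le1; apply: prov_cut Rx _.
  exact: prov_cut (provable_Fus (prov_id _) Uz2) (prov_unitr_elim _).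
(* The point [x] is its own witness, since it proves [Fus Unit x]. *)
- move=> x y xy; exists x; split=> //; exists Unit, x; split=> //.
  + exact: prov_id.
  + exact: prov_unitl_intro.
- move=> x y xy; exists x; split=> //; exists x, Unit; split=> //.
  + exact: prov_id.
  + exact: prov_unitr_intro.
Qed.

Definition canonical_model : model :=
  @Model canonical_frame (fun i => [set x | provable x (Var i)])
    (fun i => canonical_stable (Var i)).

Lemma canonical_sem f : sem canonical_model f = [set x | provable x f].
Proof.
rewrite /sem; elim: f => [i|||h IHh g IHg|g IHg h IHh|g IHg h IHh] //=.
- by apply/seteqP; split=> // x _; exact: prov_top.
(* The clause at [z = g], [v = h] already says that [x] proves the implication; monotonicity gives
   all other instances. The next two cases follow the same pattern. *)
- rewrite IHg IHh canonical_pol1; apply/seteqP; split=> x /= Hx.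
    by apply/canonical_dualS/Hx; exact: prov_id.
  move=> z v zg hv; apply/canonical_dualS.
  exact: prov_cut Hx (provable_LImp hv zg).
- rewrite IHg IHh -(canonical_pold (Fus g h)).
  apply: (f_equal (@pold canonical_frame)); apply/seteqP; split=> v /= Hv.
    by apply/canonical_dualR/Hv; exact: prov_id.
  move=> x z xg zh; apply/canonical_dualR.
  exact: prov_cut (provable_Fus xg zh) Hv.
- rewrite IHg IHh canonical_pol1; apply/seteqP; split=> z /= Hz.
    by apply/canonical_dualT/Hz; exact: prov_id.
  move=> x v xg hv; apply/canonical_dualT.
  exact: prov_cut Hz (provable_RImp xg hv).
Qed.

Theorem theorem4p1 (f g : sentence) :
  provable f g <->
  (forall M : model, LK (model_frame M) -> sem M f `<=` sem M g).
Proof.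
split=> [fg M hM|H].
  exact (soundness hM fg (@valuation_stable M)).
(* The inclusion is evaluated at the point [f], which lies in its own denotation. *)
have := H canonical_model canonical_LK; rewrite !canonical_sem; apply.
exact: prov_id.
Qed.
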